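(* Let $k$ be a field, $S=k[x_1,\dots,x_n]$, and let $\Delta$ be a simplicial complex on $[n]$. If $I_\Delta^{(t)}$ is Cohen-Macaulay for some $t\ge3$, then $I_\Delta^{(2)}$ is Cohen-Macaulay.
   Context: $[n]=\{1,\dots,n\}$. A simplicial complex on $[n]$ is a collection of subsets of $[n]$ containing $\emptyset$ and closed under taking subsets; $\mathcal F(\Delta)$ is its set of facets (maximal faces). $P_F$ is the prime ideal of $S$ generated by the $x_i$ with $i\notin F$; $I_\Delta=\bigcap_{F\in\mathcal F(\Delta)}P_F$ is the Stanley-Reisner ideal and $I_\Delta^{(m)}=\bigcap_{F\in\mathcal F(\Delta)}P_F^m$ its $m$-th symbolic power. An ideal $I$ is Cohen-Macaulay if $S/I$ is Cohen-Macaulay. *)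

(* Defs.v *)
From HB Require Import structures.
From mathcomp Require Import all_boot all_order all_algebra.
From mathcomp Require Import classical_sets.
From mathcomp Require Import mpoly.

Set Implicit Arguments.
Unset Strict Implicit.
Unset Printing Implicit Defensive.

Import GRing.Theory.
Local Open Scope classical_set_scope.
Local Open Scope ring_scope.

Section CommutativeAlgebra.
Variable A : comNzRingType.
Implicit Types (I J P M : set A) (s : seq A).

Definition is_ideal I : Prop :=
  [/\ I 0,
      forall x y, I x -> I y -> I (x + y) &
      forall a x, I x -> I (a * x)].

Definition ideal_gen (G : set A) : set A :=
  [set x | forall I, is_ideal I -> G `<=` I -> I x].

Definition ideal_pow I (m : nat) : set A :=
  ideal_gen [set x | exists2 f : 'I_m -> A,
                       forall j, I (f j) & x = \prod_(j < m) f j].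

Definition prime_ideal P : Prop :=
  [/\ is_ideal P, ~ P 1 & forall x y, P (x * y) -> P x \/ P y].

Definition maximal_ideal M : Prop :=
  [/\ is_ideal M, ~ M 1 &
      forall J, is_ideal J -> ~ J 1 -> M `<=` J -> J = M].

Definition noetherian : Prop :=
  forall I, is_ideal I -> exists s, I = ideal_gen [set` s].

Definition regular_sequence s : Prop :=
  ~ ideal_gen [set` s] 1 /\
  forall i, (i < size s)%N -> forall y,
    ideal_gen [set` take i s] (s`_i * y) -> ideal_gen [set` take i s] y.

(* depth(I, A) = d: the supremum of the lengths of the regular sequences
   contained in I is attained and equals d. *)
Definition has_depth I (d : nat) : Prop :=
  (exists s, [/\ regular_sequence s, [set` s] `<=` I & size s = d]) /\
  (forall s, regular_sequence s -> [set` s] `<=` I -> (size s <= d)%N).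

(* Q 0 < Q 1 < ... < Q h = P; the values of Q beyond h are irrelevant. *)
Definition prime_chain P (h : nat) (Q : nat -> set A) : Prop :=
  [/\ Q h = P,
      forall i, (i <= h)%N -> prime_ideal (Q i) &
      forall i, (i < h)%N -> Q i `<` Q i.+1].

Definition has_height P (h : nat) : Prop :=
  (exists Q, prime_chain P h Q) /\
  (forall h' Q, prime_chain P h' Q -> (h' <= h)%N).

(* Eisenbud's definition (Commutative Algebra, 18.2): a Noetherian ring is
   Cohen-Macaulay if depth(M, A) = codim M for every maximal ideal M.  Here
   depth(M, A) = depth A_M and codim M = height M = dim A_M, so this says that
   the local ring A_M is Cohen-Macaulay for every M. *)
Definition cohen_macaulay : Prop :=
  noetherian /\
  forall M, maximal_ideal M -> exists d, has_depth M d /\ has_height M d.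

End CommutativeAlgebra.

(* The library forms quotients only by proper ideals given as boolean
   predicates (idealr R).  J is determined by I, so that {ideal_quot J} is R / I;
   the unit ideal is not counted as Cohen-Macaulay. *)
Definition cohen_macaulay_ideal (R : comNzRingType) (I : set R) : Prop :=
  exists2 J : idealr R, (forall x, x \in J <-> I x) &
                        cohen_macaulay {ideal_quot J}.

Section StanleyReisner.
Variable n : nat.
Implicit Types (Delta : {set {set 'I_n}}) (F G : {set 'I_n}).

Definition simplicial_complex Delta : Prop :=
  finset.set0 \in Delta /\
  forall F G, F \in Delta -> G \subset F -> G \in Delta.

Definition facets Delta : {set {set 'I_n}} :=
  [set F | maxset (fun G => G \in Delta) F]%SET.

Variable k : fieldType.

Definition face_prime F : set {mpoly k[n]} :=
  ideal_gen [set f | exists2 i, i \notin F & f = 'X_i].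

(* The m-th symbolic power of the Stanley-Reisner ideal of Delta. *)
Definition sr_symbolic_power Delta (m : nat) : set {mpoly k[n]} :=
  [set f | forall F, F \in facets Delta -> ideal_pow (face_prime F) m f].

End StanleyReisner.

Arguments face_prime {n} k F.
Arguments sr_symbolic_power {n} k Delta m.

(* Main.v *)
Require Import Defs.
From HB Require Import structures.
From mathcomp Require Import all_boot all_order all_algebra.
From mathcomp Require Import boolp classical_sets.
From mathcomp Require Import mpoly ring.

(** Let I_j be the j-th symbolic power.  For m >= 1 the substitution
    x_i |-> x_i^m is a ring morphism phi from S to S, and S is a free module
    over the image of phi, with basis the monomials x^b with all exponents
    below m.  Since I_j consists of the polynomials all of whose monomials
    have degree at least j in the variables outside F, for every facet F, phi
    maps I_j to I_(jm), and the projection rho of S onto the coefficient of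
    x^0 (which keeps the monomials whose exponents are all divisible by m, and
    divides these exponents by m) maps I_t to I_j as soon as t > (j-1)m.  So
    for (j-1)m < t <= jm the ring S/I_j is a direct summand of S/I_t,
    seen as a module through phi.  With m = t - 1 this applies to j = 2.

    It remains to see that the Cohen-Macaulay property passes from S/I_t to
    S/I_j ([rel_cm_descent]).  Both ideals have the same radical, hence lie in
    the same primes, and heights agree.  A regular sequence in a maximal ideal
    M has length at most the height of M: each regular element allows one to
    pass to a strictly smaller prime ([chain_of_rseq]).  For the converse one
    builds a sequence s of length height(M) in M with phi(s) regular on S/I_t;
    then s is regular on the direct summand S/I_j ([rseq_descent]).  If s
    cannot be extended, then phi(M) consists of zero divisors modulo
    I_t + (phi(s)), so by prime avoidance it lies in an associated prime Q
    ([common_nzd]), and then phi^-1(Q) = M.  The ring extension phi is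
    integral, so Q is maximal ([integral_maximal]), and it is free, so going
    down holds ([free_going_down]) and height(Q) >= height(M).  As S/I_t is
    Cohen-Macaulay at Q, there is a regular sequence of length height(Q) in Q.
    But phi(s) is a maximal regular sequence in Q, because Q is associated to
    I_t + (phi(s)), and all maximal regular sequences in an ideal have the
    same length ([rseq_size_socle]), so s already has length height(M).

    All notions are developed in S relative to an ideal J, and are identified
    with those of S/J at the end ([cohen_macaulay_quotient]). *)

Set Implicit Arguments.
Unset Strict Implicit.
Unset Printing Implicit Defensive.

Import GRing.Theory.
Local Open Scope classical_set_scope.
Local Open Scope ring_scope.

(** * Ideals, regular sequences and primes *)

Section Ideals.
Variable R : comNzRingType.
Implicit Types (I J K P Q M : set R) (s t : seq R) (x y z u v w : R).

Section IdealClosure.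
Variables (I : set R) (idI : is_ideal I).

Lemma ideal0 : I 0. Proof. by case: idI. Qed.

Lemma idealD x y : I x -> I y -> I (x + y).
Proof. by case: idI => _ + _; apply. Qed.

Lemma idealMl a x : I x -> I (a * x).
Proof. by case: idI => _ _; apply. Qed.

Lemma idealMr a x : I x -> I (x * a).
Proof. by rewrite mulrC; apply: idealMl. Qed.

Lemma idealN x : I x -> I (- x).
Proof. by rewrite -mulN1r; apply: idealMl. Qed.

Lemma idealB x y : I x -> I y -> I (x - y).
Proof. by move=> Ix /idealN; apply: idealD. Qed.

Lemma ideal_sum (T : Type) (r : seq T) (p : pred T) (F : T -> R) :
  (forall i, p i -> I (F i)) -> I (\sum_(i <- r | p i) F i).
Proof. by move=> IF; apply: big_ind => //; [exact: ideal0 | exact: idealD]. Qed.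

End IdealClosure.

Lemma ideal_gen_ideal (G : set R) : is_ideal (ideal_gen G).
Proof.
split=> [I idI _|x y Gx Gy I idI GI|a x Gx I idI GI]; first exact: ideal0.
  by apply: idealD => //; [apply: Gx | apply: Gy].
by apply: idealMl => //; apply: Gx.
Qed.

Lemma ideal_gen_sub (G : set R) : G `<=` ideal_gen G.
Proof. by move=> x Gx I _; apply. Qed.

Lemma prime_ideal_ideal P : prime_ideal P -> is_ideal P.
Proof. by case. Qed.

Lemma primeX P x n : prime_ideal P -> P (x ^+ n) -> P x.
Proof.
move=> [_ P1 pP]; elim: n => [|n IHn]; first by rewrite expr0.
by rewrite exprS => /pP [].
Qed.

(** The ideal J + (x), as a membership condition. *)
Definition adjoin J x : set R := [set w | exists c, J (w - c * x)].

Lemma adjoin_ideal J x : is_ideal J -> is_ideal (adjoin J x).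
Proof.
move=> idJ; split.
- by exists 0; rewrite mul0r subr0; apply: ideal0.
- move=> y z [a Ja] [b Jb]; exists (a + b).
  by rewrite mulrDl opprD addrACA; apply: idealD.
- move=> a y [b Jb]; exists (a * b).
  by rewrite -mulrA -mulrBr; apply: idealMl.
Qed.

Lemma sub_adjoin J x : J `<=` adjoin J x.
Proof. by move=> y Jy; exists 0; rewrite mul0r subr0. Qed.

Lemma mem_adjoin J x : is_ideal J -> adjoin J x x.
Proof. by move=> idJ; exists 1; rewrite mul1r subrr; apply: ideal0. Qed.

Lemma adjoin_min I J x : is_ideal I -> J `<=` I -> I x -> adjoin J x `<=` I.
Proof.
move=> idI JI Ix y [c /JI Iy]; rewrite -[y](subrK (c * x)).
by apply: idealD => //; apply: idealMl.
Qed.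

Lemma adjoinC J x y : is_ideal J -> adjoin (adjoin J x) y = adjoin (adjoin J y) x.
Proof.
move=> idJ; have sub a b : adjoin (adjoin J a) b `<=` adjoin (adjoin J b) a.
  have idb := adjoin_ideal b idJ; have idba := adjoin_ideal a idb.
  have bba := @sub_adjoin (adjoin J b) a.
  apply: adjoin_min => //; last exact/bba/mem_adjoin.
  apply: adjoin_min => //; last exact: mem_adjoin.
  by move=> z Jz; apply/bba/sub_adjoin.
by apply/seteqP; split; apply: sub.
Qed.

Notation adjoins := (foldl adjoin).

Lemma adjoins_ideal J s : is_ideal J -> is_ideal (adjoins J s).
Proof. by elim: s J => //= x s IHs J idJ; apply/IHs/adjoin_ideal. Qed.

Lemma sub_adjoins J s : J `<=` adjoins J s.
Proof.
by elim: s J => [|x s IHs] J y Jy //=; apply/IHs/sub_adjoin.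
Qed.

Lemma mem_adjoins J s : is_ideal J -> [set` s] `<=` adjoins J s.
Proof.
elim: s J => [|x s IHs] J idJ y //=; rewrite inE => /orP[/eqP->|ys].
  exact/sub_adjoins/mem_adjoin.
by apply: IHs => //; apply: adjoin_ideal.
Qed.

Lemma adjoins_min I J s :
  is_ideal I -> J `<=` I -> [set` s] `<=` I -> adjoins J s `<=` I.
Proof.
move=> idI; elim: s J => //= x s IHs J JI sI; apply: IHs.
  by apply: adjoin_min => //; apply: sI; rewrite /= mem_head.
by move=> y ys; apply: sI; rewrite /= inE [y \in s]ys orbT.
Qed.

Lemma adjoin_adjoins J s x : is_ideal J ->
  adjoin (adjoins J s) x = adjoins (adjoin J x) s.
Proof.
elim: s J => //= y s IHs J idJ; rewrite IHs ?(adjoinC y) //.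
exact: adjoin_ideal.
Qed.

Lemma adjoins_rcons J s x : adjoins J (rcons s x) = adjoin (adjoins J s) x.
Proof. by rewrite -cats1 foldl_cat. Qed.

Definition nzd J x := forall y, J (x * y) -> J y.

(** The recursion on the first element moves it into the base ideal.  This is the
    form in which inductions on regular sequences run; [rseq_nth] is the usual one. *)
Fixpoint rseq J s := if s is x :: s' then nzd J x /\ rseq (adjoin J x) s' else True.

Lemma rseq_cat J s t : rseq J (s ++ t) <-> rseq J s /\ rseq (adjoins J s) t.
Proof. by elim: s J => [|x s IHs] J //=; [tauto | rewrite IHs; tauto]. Qed.

Lemma rseq_rcons J s x : rseq J (rcons s x) <-> rseq J s /\ nzd (adjoins J s) x.
Proof. by rewrite -cats1 rseq_cat /=; tauto. Qed.

Lemma rseq_nth J s :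
  rseq J s <-> forall i, (i < size s)%N -> nzd (adjoins J (take i s)) s`_i.
Proof.
elim: s J => [|x s IHs] J //=; rewrite IHs; split=> [[Jx Js] [|i] //|Js].
  by apply: Js.
by split=> [|i]; [apply: (Js 0) | apply: (Js i.+1)].
Qed.

(** Zorn's lemma above a given element.  It is applied to nonempty chains only,
    the union of the empty chain being the empty set, which is not an ideal. *)
Lemma zorn_above (P : set R -> Prop) I0 : P I0 ->
  (forall F : set (set R), F `<=` P -> F !=set0 -> total_on F subset ->
     P (\bigcup_(X in F) X)) ->
  exists M, [/\ P M, I0 `<=` M & forall B, P B -> M `<=` B -> B = M].
Proof.
move=> P0 chainP.
have [F FP Ftot|A [PA maxA]] := @Zorn_bigcup R [set X | P (I0 `|` X)].
  rewrite /=; have [->|/set0P[X0 FX0]] := eqVneq F set0.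
    by rewrite bigcup_set0 setU0.
  rewrite -[I0 `|` _](_ : \bigcup_(X in [set I0 `|` Y | Y in F]) X = _).
    apply: chainP => [_ [X FX <-]||_ _ [X FX <-] [Y FY <-]]; first exact: FP.
      by exists (I0 `|` X0), X0.
    by have [XY|YX] := Ftot _ _ FX FY; [left|right]; apply: setUS.
  apply/seteqP; split=> x.
    by move=> [_ [X FX <-]] [I0x|Xx]; [left | right; exists X].
  by case=> [I0x|[X FX Xx]]; [exists (I0 `|` X0) => //; [exists X0|left]
                      | exists (I0 `|` X) => //; [exists X|right]].
exists (I0 `|` A); split=> // B PB AB.
have/seteqP[I0B AB'] : I0 `|` B = B by apply/setUidPr => x I0x; apply: AB; left.
apply/seteqP; split=> // x Bx; right; apply: contrapT => nAx.
apply: (maxA B); last by rewrite /= (_ : I0 `|` B = B) //; apply/seteqP.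
by split=> [y Ay|BA]; [apply: AB; right | apply/nAx/BA].
Qed.

Lemma bigcup_ideal (F : set (set R)) :
  (forall I, F I -> is_ideal I) -> F !=set0 -> total_on F subset ->
  is_ideal (\bigcup_(X in F) X).
Proof.
move=> Fid [I0 FI0] Ftot; split.
- by exists I0 => //; exact: ideal0 (Fid _ FI0).
- move=> x y [X FX Xx] [Y FY Yy]; have [XY|YX] := Ftot _ _ FX FY.
    by exists Y => //; apply: (idealD (Fid _ FY)) => //; apply: XY.
  by exists X => //; apply: (idealD (Fid _ FX)) => //; apply: YX.
- by move=> a x [X FX Xx]; exists X => //; apply: (idealMl (Fid _ FX)).
Qed.

(** An ideal maximal among those disjoint from a multiplicative set T is prime: if
    it contains neither x nor y, then adjoining either of them produces an element
    of T, and the product of the two elements is in the ideal when x * y is. *)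
Lemma prime_avoiding J (T : set R) :
  is_ideal J -> T 1 -> (forall x y, T x -> T y -> T (x * y)) ->
  (forall x, T x -> ~ J x) ->
  exists P, [/\ prime_ideal P, J `<=` P & forall x, T x -> ~ P x].
Proof.
move=> idJ T1 TM TJ.
pose A I := is_ideal I /\ forall x, T x -> ~ I x.
have [|F FA F0 Ftot|P [[idP PT] JP maxP]] := @zorn_above A J; first by split.
  split=> [|x Tx [X /FA[_ XT]]]; last exact: XT.
  by apply: bigcup_ideal => // I /FA[].
exists P; split=> //; split=> //; first by move/PT; apply.
have enlarge x : ~ P x -> exists2 t, T t & adjoin P x t.
  move=> nPx; apply: contrapT => nT; apply: nPx.
  rewrite -(maxP (adjoin P x)); [exact: mem_adjoin| | exact: sub_adjoin].
  by split=> [|t Tt xt]; [exact: adjoin_ideal | apply: nT; exists t].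
move=> x y Pxy; apply: contrapT => /not_orP[/enlarge[t Tt [a Pa]]].
move=> /enlarge[t' Tt' [b Pb]]; apply: (PT (t * t')); first exact: TM.
have -> : t * t' = t' * (t - a * x) + a * x * (t' - b * y) + (a * b) * (x * y).
  by ring.
by apply: idealD => //; [apply: idealD => //|]; apply: idealMl.
Qed.

Lemma maximal_prime M : maximal_ideal M -> prime_ideal M.
Proof.
move=> [idM M1 maxM]; split=> // x y Mxy; apply: contrapT => /not_orP[nx ny].
have [J1|nJ1] := EM (adjoin M x 1); last first.
  apply: nx; rewrite -(maxM (adjoin M x)) //; first exact: mem_adjoin.
    exact: adjoin_ideal.
  exact: sub_adjoin.
case: J1 => c Mc; apply: ny.
have -> : y = y * (1 - c * x) + c * (x * y) by ring.
by apply: idealD => //; apply: idealMl.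
Qed.

(** If x is regular modulo J and in Q, no element g * x ^+ n with g outside Q lies in
    J; a prime containing J and avoiding all of these lies in Q and misses x. *)
Lemma prime_below J Q x : is_ideal J -> prime_ideal Q -> J `<=` Q -> nzd J x ->
  exists P, [/\ prime_ideal P, J `<=` P, P `<=` Q & ~ P x].
Proof.
move=> idJ pQ JQ Jx; pose T := [set z | exists g n, ~ Q g /\ z = g * x ^+ n].
have [||_ _ [g [n [Qg ->]]] [h [m [Qh ->]]]|_ [g [n [Qg ->]]] Jgx|P [pP JP PT]]
   := @prime_avoiding J T => //.
- by exists 1, 0; rewrite mulr1; split=> //; case: pQ.
- exists (g * h), (n + m)%N; rewrite exprD mulrACA; split=> //.
  by case: pQ => _ _ pQ /pQ[].
- apply/Qg/JQ; elim: n Jgx => [|n IHn]; first by rewrite mulr1.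
  by rewrite exprS mulrCA => /Jx.
exists P; split=> // [y Py|Px].
  apply: contrapT => Qy; apply: PT Py; exists y, 0; by rewrite mulr1.
apply: PT Px; exists 1, 1; rewrite mul1r; split=> //; by case: pQ.
Qed.

(** The easy half of the comparison of depth and height.  The chain is built from
    the end of the sequence: once J + (x) has a chain, [prime_below] adds a prime
    that misses x under its first member. *)
Lemma chain_of_rseq J M s :
  is_ideal J -> prime_ideal M -> adjoins J s `<=` M -> rseq J s ->
  exists2 Q, prime_chain M (size s) Q & J `<=` Q 0.
Proof.
elim: s J => [|x s IHs] J idJ pM /= sM.
  by move=> _; exists (fun=> M) => //; split=> // i; rewrite leqn0 => /eqP->.
case=> Jx /(IHs _ (adjoin_ideal x idJ) pM sM) [Q [Qs pQ ltQ] JQ].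
have JxQ0 : J `<=` Q 0 by move=> z Jz; apply/JQ/sub_adjoin.
have [|P [pP JP PQ Px]] := prime_below idJ _ JxQ0 Jx; first exact: pQ.
exists (fun i => if i is i'.+1 then Q i' else P) => //; split=> //.
  by case=> // i; apply: pQ.
case=> [_|i]; last exact: ltQ.
by split=> // QP; apply/Px/QP/JQ; apply: mem_adjoin.
Qed.

End Ideals.
Notation adjoins := (foldl (@adjoin _)).
(** * Associated primes and prime avoidance *)

Section Noetherian.
Variable R : comNzRingType.
Implicit Types (I J K P Q M : set R) (s t : seq R) (x y z u v w : R).

(** The quotient by J is noetherian. *)
Definition noeth_mod J :=
  forall I, is_ideal I -> J `<=` I -> exists s, I = adjoins J s.

Lemma noeth_modS J K :
  is_ideal J -> is_ideal K -> J `<=` K -> noeth_mod J -> noeth_mod K.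
Proof.
move=> idJ idK JK Jn I idI KI; have JI x : J x -> I x by move/JK/KI.
have [|s Is] := Jn I idI; first exact: JI.
exists s; apply/seteqP; split; last first.
  by apply: adjoins_min => //; rewrite Is; apply: mem_adjoins.
rewrite {1}Is; apply: adjoins_min; first exact: adjoins_ideal.
  by move=> x /JK; apply: sub_adjoins.
exact: mem_adjoins.
Qed.

Lemma chain_finite (F : set (set R)) s :
  F !=set0 -> total_on F subset -> [set` s] `<=` \bigcup_(X in F) X ->
  exists2 X, F X & [set` s] `<=` X.
Proof.
move=> [X0 FX0] Ftot; elim: s => [|x s IHs] sF; first by exists X0.
have [y ys|X FX sX] := IHs; first by apply: sF; rewrite /= inE [y \in s]ys orbT.
have [|Y FY Yx] := sF x; first by rewrite /= mem_head.
have [XY|YX] := Ftot _ _ FX FY; [exists Y|exists X] => // y; rewrite /= inE.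
  by case/orP=> [/eqP->//|ys]; apply/XY/sX.
by case/orP=> [/eqP->//|ys]; [apply/YX | apply/sX].
Qed.

(** Noetherian maximality.  The union of a chain is an ideal, hence finitely
    generated modulo J, so one member of the chain contains all its generators. *)
Lemma noeth_max J (A : set R -> Prop) I0 :
  is_ideal J -> noeth_mod J -> (forall I, A I -> is_ideal I /\ J `<=` I) ->
  A I0 -> exists M, [/\ A M, I0 `<=` M & forall B, A B -> M `<=` B -> B = M].
Proof.
move=> idJ Jn AJ AI0; apply: zorn_above AI0 _ => F FA F0 Ftot.
have idU : is_ideal (\bigcup_(X in F) X).
  by apply: bigcup_ideal => // I /FA /AJ[].
have JU : J `<=` \bigcup_(X in F) X.
  by case: F0 => X FX x Jx; exists X => //; apply: (AJ _ (FA _ FX)).2.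
have [s Us] := Jn _ idU JU.
have [|X FX sX] := @chain_finite F s F0 Ftot.
  by rewrite Us; apply: mem_adjoins.
have [idX JX] := AJ _ (FA _ FX).
have -> : \bigcup_(X in F) X = X; last exact: FA.
apply/seteqP; split=> [|x Xx]; last by exists X.
by rewrite Us; apply: adjoins_min.
Qed.

Definition colon K u : set R := [set w | K (w * u)].

Lemma colon_ideal K u : is_ideal K -> is_ideal (colon K u).
Proof.
move=> idK; split; rewrite /colon /=.
- by rewrite mul0r; apply: ideal0.
- by move=> x y Kx Ky; rewrite mulrDl; apply: idealD.
- by move=> a x Kx; rewrite -mulrA; apply: idealMl.
Qed.

Lemma sub_colon K u : is_ideal K -> K `<=` colon K u.
Proof. by move=> idK x Kx; apply: idealMr. Qed.

(** The annihilator of the class of u is maximal among the annihilators of nonzero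
    classes modulo K. *)
Definition max_colon K u :=
  ~ K u /\ forall v, ~ K v -> colon K u `<=` colon K v -> colon K v = colon K u.

Lemma max_colon_prime K u : is_ideal K -> max_colon K u -> prime_ideal (colon K u).
Proof.
move=> idK [Ku maxu]; split; first exact: colon_ideal; first by rewrite /colon /= mul1r.
move=> x y; rewrite {1}/colon /= => Kxyu; apply: contrapT => /not_orP[Kxu Kyu].
apply: Kxu; rewrite -(maxu (y * u)) //; first by rewrite /colon /= mulrA.
by move=> w Kwu; rewrite /colon /= mulrCA; apply: idealMl.
Qed.

Lemma max_colon_above J K v :
  is_ideal J -> noeth_mod J -> is_ideal K -> J `<=` K -> ~ K v ->
  exists2 u, max_colon K u & colon K v `<=` colon K u.
Proof.
move=> idJ Jn idK JK Kv; pose A I := exists2 u, ~ K u & I = colon K u.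
have [I [u _ ->]||_ [[u Ku ->] vu maxu]] := @noeth_max J A (colon K v) idJ Jn.
- by split=> [|x /JK Kx]; [exact: colon_ideal|exact: sub_colon].
- by exists v.
by exists u => //; split=> // w Kw uw; apply: maxu => //; exists w.
Qed.

(** A prime P contains the intersection of finitely many ideals only if it contains
    one of them.  The element w witnesses this for the ideals that P does not
    contain, whichever they are. *)
Lemma separate (T : eqType) (r : seq T) (A : T -> set R) P :
  prime_ideal P -> (forall i, i \in r -> is_ideal (A i)) ->
  exists2 w, ~ P w & forall i, i \in r -> A i `<=` P \/ A i w.
Proof.
move=> pP; elim: r => [|i r IHr] idA; first by exists 1 => //; case: pP.
have [j jr|w Pw wA] := IHr; first by apply: idA; rewrite inE jr orbT.
have idAi := idA i (mem_head _ _).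
have [iP|/existsNP[v /not_implyP[Av Pv]]] := EM (A i `<=` P).
  by exists w => // j; rewrite inE => /orP[/eqP->|/wA//]; left.
exists (v * w) => [|j]; first by case: pP => _ _ pP /pP[].
rewrite inE => /orP[/eqP->|jr]; first by right; apply: idealMr.
have [|Aw] := wA _ jr; [by left | right].
by apply: idealMl => //; apply: idA; rewrite inE jr orbT.
Qed.

(** In the inductive step x avoids all primes but the first, P, and lies in P.
    Adding an element of Q outside P that lies in every other prime not contained
    in P repairs this: the sum avoids P, hence also the primes contained in P. *)
Lemma prime_avoidance (us : seq (set R)) Q :
  is_ideal Q -> (forall P, P \in us -> prime_ideal P) ->
  (forall P, P \in us -> ~ (Q `<=` P)) ->
  exists2 x, Q x & forall P, P \in us -> ~ P x.
Proof.
move=> idQ; elim: us => [|P us IHus] pr nQ; first by exists 0 => //; apply: ideal0.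
have [P' P'us|P' P'us|x Qx xus] := IHus.
- by apply: pr; rewrite inE P'us orbT.
- by apply: nQ; rewrite inE P'us orbT.
have pP := pr _ (mem_head _ _).
have [Px|Px] := EM (P x); last first.
  by exists x => // P'; rewrite inE => /orP[/eqP->|/xus].
have /existsNP[z /not_implyP[Qz Pz]] := nQ _ (mem_head _ _).
have prus P' : P' \in us -> prime_ideal P'.
  by move=> P'us; apply: pr; rewrite inE P'us orbT.
have [P' /prus[]//|w Pw wus] := @separate _ us id P pP.
have Pxzw : ~ P (x + z * w).
  move=> /(idealB (prime_ideal_ideal pP)) /(_ Px); rewrite addrAC subrr add0r.
  by case: pP => _ _ pP /pP[].
exists (x + z * w); first by apply: idealD => //; apply: idealMr.
move=> P'; rewrite inE => /orP[/eqP->//|P'us].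
have [P'P /P'P //|P'w] := wus _ P'us.
have idP' := prime_ideal_ideal (prus _ P'us).
move=> /(idealB idP') /(_ (idealMl idP' z P'w)); rewrite addrK.
exact: xus.
Qed.

(** Choose finitely many classes with maximal annihilators such that the ideal they
    generate with K is as large as possible.  It then contains every class v whose
    annihilator is maximal.  So the annihilator of v contains the intersection of
    the chosen annihilators, and being prime it contains, hence equals, one of
    them. *)
Lemma max_colon_finite J K :
  is_ideal J -> noeth_mod J -> is_ideal K -> J `<=` K ->
  exists us : seq R, (forall u, u \in us -> max_colon K u) /\
    forall v, max_colon K v -> exists2 u, u \in us & colon K v = colon K u.
Proof.
move=> idJ Jn idK JK.
pose A I := exists2 us, (forall u, u \in us -> max_colon K u) & I = adjoins K us.
have [I [us _ ->]||_ [[us usK ->] _ maxus]] := @noeth_max J A K idJ Jn.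
- by split=> [|x /JK Kx]; [exact: adjoins_ideal | exact: sub_adjoins].
- by exists [::].
exists us; split=> // v maxv; have pv := max_colon_prime idK maxv.
have usv : adjoins K us v.
  have <- : adjoins K (rcons us v) = adjoins K us.
    apply: maxus; last by rewrite adjoins_rcons; apply: sub_adjoin.
    by exists (rcons us v) => // u; rewrite mem_rcons inE => /orP[/eqP->|/usK].
  by apply: mem_adjoins => //=; rewrite mem_rcons mem_head.
have [u /usK uK|w nvw wus] := @separate _ us (colon K) _ pv.
  exact: colon_ideal.
have [[u [uus uv]]|nuv] := EM (exists u, u \in us /\ colon K u `<=` colon K v).
  by exists u => //; case: (usK _ uus) => Ku; apply => //; case: maxv.
case: nvw; rewrite /colon /= mulrC.
suff: adjoins K us `<=` colon K w by apply.
apply: adjoins_min; [exact: colon_ideal|exact: sub_colon|].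
move=> u uus; rewrite /colon /= mulrC.
by have [uv|//] := wus _ uus; case: nuv; exists u.
Qed.

Lemma zerodivisor_primes J (Ks : seq (set R)) :
  is_ideal J -> noeth_mod J ->
  (forall K, K \in Ks -> is_ideal K /\ J `<=` K) ->
  exists Ps : seq (set R),
    (forall P, P \in Ps -> prime_ideal P /\
       exists K u, [/\ K \in Ks, ~ K u & P = colon K u]) /\
    forall K x, K \in Ks -> (forall P, P \in Ps -> ~ P x) -> nzd K x.
Proof.
move=> idJ Jn; elim: Ks => [|K Ks IHKs] KsJ; first by exists [::].
have [K' K'Ks|Ps [PsP xPs]] := IHKs; first by apply: KsJ; rewrite inE K'Ks orbT.
have [idK JK] := KsJ K (mem_head _ _).
have [us [usK maxus]] := max_colon_finite idJ Jn idK JK.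
exists ([seq colon K u | u <- us] ++ Ps); split=> [P|K' x].
  rewrite mem_cat => /orP[/mapP[u /usK uK ->]|/PsP[pP [K' [u [K'Ks Ku eP]]]]].
    split; first exact: max_colon_prime.
    by exists K, u; rewrite mem_head; split=> //; case: uK.
  by split=> //; exists K', u; rewrite inE K'Ks orbT.
rewrite inE => /orP[/eqP->|K'Ks] xP; last first.
  by apply: xPs K'Ks _ => P PPs; apply: xP; rewrite mem_cat PPs orbT.
move=> y Kxy; apply: contrapT => Ky.
have [u uK yu] := max_colon_above idJ Jn idK JK Ky.
have [v vus uv] := maxus u uK.
apply: (xP (colon K v)); first by rewrite mem_cat map_f.
by rewrite -uv; apply: yu.
Qed.

End Noetherian.

Section Preimage.
Variables (R' R : comNzRingType) (phi : {rmorphism R' -> R}).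

Lemma preimage_ideal (I : set R) : is_ideal I -> is_ideal (phi @^-1` I).
Proof.
move=> idI; split; rewrite /preimage /=.
- by rewrite rmorph0; apply: ideal0.
- by move=> x y Ix Iy; rewrite rmorphD; apply: idealD.
- by move=> a x Ix; rewrite rmorphM; apply: idealMl.
Qed.

Lemma preimage_prime (P : set R) : prime_ideal P -> prime_ideal (phi @^-1` P).
Proof.
move=> [idP P1 pP]; split; first exact: preimage_ideal.
  by rewrite /preimage /= rmorph1.
by move=> x y; rewrite /preimage /= rmorphM; apply: pP.
Qed.

(** Prime avoidance for the associated primes of several ideals at once, pulled back
    along phi.  The second alternative exhibits an associated prime that contains
    the image of Q. *)
Lemma common_nzd (J : set R) (Ks : seq (set R)) (Q : set R') :
  is_ideal J -> noeth_mod J ->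
  (forall K, K \in Ks -> is_ideal K /\ J `<=` K) -> is_ideal Q ->
  (exists2 x, Q x & forall K, K \in Ks -> nzd K (phi x)) \/
  exists K u, [/\ K \in Ks, ~ K u, prime_ideal (colon K u) &
                 forall x, Q x -> K (phi x * u)].
Proof.
move=> idJ Jn KsJ idQ; have [Ps [PsP nPs]] := zerodivisor_primes idJ Jn KsJ.
have [[P [PPs QP]]|nQP] :=
    EM (exists P, P \in Ps /\ Q `<=` phi @^-1` P).
  have [pP [K [u [KKs Ku eP]]]] := PsP _ PPs; right; exists K, u.
  by rewrite -eP; split=> // x /QP; rewrite /preimage /= eP.
have [_ /mapP[P PPs ->]|_ /mapP[P PPs ->] QP|x Qx xP] :=
    @prime_avoidance _ [seq phi @^-1` P | P <- Ps] Q idQ.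
- by apply: preimage_prime; case: (PsP _ PPs).
- by apply: nQP; exists P.
left; exists x => // K KKs; apply: nPs => // P PPs Px.
by apply: (xP (phi @^-1` P)) => //; apply: map_f.
Qed.

End Preimage.

(** * Invariance of the length of maximal regular sequences *)

Section Rees.
Variable R : comNzRingType.
Implicit Types (J K Q : set R) (s t : seq R).

(** Nonvanishing of the module of homomorphisms from R / Q to R / K.  For K generated
    by a regular sequence in Q it says that this sequence is maximal in Q. *)
Definition socle K Q := exists2 u, ~ K u & forall x, Q x -> K (x * u).

(** If u kills Q modulo K + (a), write b * u = v * a modulo K; then v kills Q
    modulo K + (b), by cancelling a, and v is nonzero there, by cancelling b. *)
Lemma socle_exchange K Q a b :
  is_ideal K -> Q a -> Q b -> nzd K a -> nzd K b ->
  socle (adjoin K a) Q -> socle (adjoin K b) Q.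
Proof.
move=> idK Qa Qb Ka Kb [u Kau Qu]; have [v Kv] := Qu _ Qb.
exists v => [[w Kw]|x Qx].
  apply: Kau; exists w; apply: Kb.
  have -> : b * (u - w * a) = (b * u - v * a) + a * (v - w * b) by ring.
  by apply: idealD => //; apply: idealMl.
have [c Kc] := Qu _ Qx; exists c; apply: Ka.
have -> : a * (x * v - c * b) = b * (x * u - c * a) - x * (b * u - v * a).
  by ring.
by apply: idealB => //; apply: idealMl.
Qed.

(** A regular sequence stays regular modulo an element z that is regular modulo each
    of its initial segments: z can be moved to the front of the sequence. *)
Lemma rseq_adjoin J s z : is_ideal J -> rseq J s ->
  (forall i, (i <= size s)%N -> nzd (adjoins J (take i s)) z) ->
  rseq (adjoin J z) s.
Proof.
elim: s J => [|x s IHs] J idJ //= [Jx Js] zs; split; last first.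
  rewrite adjoinC //; apply: IHs => // [|i]; first exact: adjoin_ideal.
  exact: (zs i.+1).
have Jz : nzd J z by apply: (zs 0).
have Jxz : nzd (adjoin J x) z by have := zs 1 isT; rewrite /= take0.
move=> y [w Jw]; have [|c Jc] := Jxz w.
  exists y; have -> : z * w - y * x = - (x * y - w * z) by ring.
  exact: idealN.
exists c; apply: Jx.
have -> : x * (y - c * z) = (x * y - w * z) + z * (w - c * x) by ring.
by apply: idealD => //; apply: idealMl.
Qed.

(** Maximality in Q does not depend on the regular sequence of a given length.  An
    element z of Q, regular modulo all initial segments of both sequences, replaces
    both last elements by [socle_exchange]; after moving z to the front, the
    induction hypothesis applies modulo z. *)
Lemma socle_rseq J Q s t :
  is_ideal J -> noeth_mod J -> is_ideal Q ->
  rseq J s -> rseq J t -> [set` s] `<=` Q -> [set` t] `<=` Q ->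
  size s = size t -> socle (adjoins J s) Q -> socle (adjoins J t) Q.
Proof.
move=> + + idQ; elim/last_ind: s J t => [|s a IHs] J t idJ Jn.
  by case: t.
case/lastP: t => [|t b]; rewrite ?size_rcons // => Js Jt sQ tQ [sz].
pose pre r := [seq adjoins J (take i r) | i <- iota 0 (size r)].
have preP r K : K \in pre r -> exists2 i, (i < size r)%N & K = adjoins J (take i r).
  by move=> /mapP[i]; rewrite mem_iota add0n => /andP[_ ir] ->; exists i.
have preQ r : rseq J r -> [set` r] `<=` Q -> forall K, K \in pre r ->
   exists2 x, Q x & nzd K x.
  move=> /rseq_nth Jr rQ K /preP[i ir ->]; exists r`_i; last exact: Jr.
  by apply: rQ; apply: mem_nth.
have [K|[z Qz zK]|[K [u [Kst Ku _ Qu]]]] :=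
    @common_nzd _ _ idfun J (pre (rcons s a) ++ pre (rcons t b)) Q idJ Jn _ idQ.
- rewrite mem_cat => /orP[] /preP[i _ ->].
    by split; [exact: adjoins_ideal|exact: sub_adjoins].
  by split; [exact: adjoins_ideal|exact: sub_adjoins].
- have zpre r c i : (forall K, K \in pre (rcons r c) -> nzd K z) ->
      (i <= size r)%N -> nzd (adjoins J (take i r)) z.
    move=> rc ir; rewrite -(takel_cat [:: c] ir) cats1; apply: rc.
    by apply: map_f; rewrite mem_iota add0n size_rcons ltnS.
  have zs i : (i <= size s)%N -> nzd (adjoins J (take i s)) z.
    by apply: (zpre s a) => K Ks; apply: zK; rewrite mem_cat Ks.
  have zt i : (i <= size t)%N -> nzd (adjoins J (take i t)) z.
    by apply: (zpre t b) => K Ks; apply: zK; rewrite mem_cat Ks orbT.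
  have [idJs idJt] := (adjoins_ideal s idJ, adjoins_ideal t idJ).
  have [Jss Ja] := (rseq_rcons _ _ _).1 Js; have [Jtt Jb] := (rseq_rcons _ _ _).1 Jt.
  have Qa : Q a by apply: sQ; rewrite /= mem_rcons mem_head.
  have Qb : Q b by apply: tQ; rewrite /= mem_rcons mem_head.
  have Jsz : nzd (adjoins J s) z by rewrite -(take_size s); apply: zs.
  have Jtz : nzd (adjoins J t) z by rewrite -(take_size t); apply: zt.
  rewrite !adjoins_rcons => /(socle_exchange idJs Qa Qz Ja Jsz).
  rewrite adjoin_adjoins // => soc; apply: (socle_exchange idJt Qz Qb Jtz Jb).
  rewrite adjoin_adjoins //; apply: (IHs (adjoin J z)) => //.
  + exact: adjoin_ideal.
  + by apply: (noeth_modS idJ) => //; [exact: adjoin_ideal|exact: sub_adjoin].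
  + exact: rseq_adjoin.
  + exact: rseq_adjoin.
  + by move=> x xs; apply: sQ; rewrite /= mem_rcons inE [x \in s]xs orbT.
  + by move=> x xt; apply: tQ; rewrite /= mem_rcons inE [x \in t]xt orbT.
have [x Qx Kx] : exists2 x, Q x & nzd K x.
  by move: Kst; rewrite mem_cat => /orP[]; apply: preQ.
by case: Ku; apply/Kx/Qu.
Qed.

Lemma rseq_size_socle J Q s t :
  is_ideal J -> noeth_mod J -> is_ideal Q ->
  rseq J s -> rseq J t -> [set` s] `<=` Q -> [set` t] `<=` Q ->
  socle (adjoins J s) Q -> (size t <= size s)%N.
Proof.
move=> idJ Jn idQ Js Jt sQ tQ soc; rewrite leqNgt; apply/negP => st.
have := Jt; rewrite -(cat_take_drop (size s) t) => /rseq_cat[Jt' Jt''].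
have [u Ku Qu] : socle (adjoins J (take (size s) t)) Q.
  apply: socle_rseq soc => //; last by rewrite size_takel // ltnW.
  by move=> x /mem_take; apply: tQ.
move: Jt''; rewrite (drop_nth 0 st) /= => -[nz _]; apply/Ku/nz/Qu/tQ.
exact: mem_nth.
Qed.
End Rees.
(** * Descent of the Cohen-Macaulay property to a direct summand *)

Section RelativeCM.
Variable R : comNzRingType.
Implicit Types (J M : set R) (s : seq R).

(** For a proper ideal M that contains J, the sequences counted here generate a
    proper ideal together with J, as regular sequences in the quotient do. *)
Definition rel_depth J M d :=
  (exists s, [/\ rseq J s, [set` s] `<=` M & size s = d]) /\
  forall s, rseq J s -> [set` s] `<=` M -> (size s <= d)%N.

Definition rel_height J M h :=
  (exists2 Q, prime_chain M h Q & J `<=` Q 0) /\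
  forall h' Q, prime_chain M h' Q -> J `<=` Q 0 -> (h' <= h)%N.

Definition rel_cm J :=
  noeth_mod J /\ forall M, maximal_ideal M -> J `<=` M ->
    exists d, rel_depth J M d /\ rel_height J M d.

End RelativeCM.

Section Integral.
Variables (R' R : comNzRingType) (phi : {rmorphism R' -> R}).

(** Lying over a maximal ideal forces maximality in an integral extension.  If y
    were in a larger proper ideal but not in Q, then no monic polynomial over the
    image of phi could take a value in Q at y: its constant term would be in Q,
    and dividing by y would lower the degree. *)
Lemma integral_maximal (Q : set R) : integralRange phi ->
  prime_ideal Q -> maximal_ideal (phi @^-1` Q) -> maximal_ideal Q.
Proof.
move=> intR [idQ Q1 pQ] [_ _ maxQ]; split=> // I idI I1 QI.
apply/seteqP; split=> // y Iy; apply: contrapT => Qy.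
have [p mon_p /rootP py0] := intR y.
suff : ~ Q (map_poly phi p).[y] by rewrite py0; apply; apply: ideal0.
elim/poly_ind: p mon_p {py0} => [|p c IHp] mon_p.
  by rewrite monicE lead_coef0 eq_sym oner_eq0 in mon_p.
rewrite rmorphD rmorphM /= map_polyX map_polyC /= hornerD hornerMX hornerC.
have [p0|p0] := eqVneq p 0.
  move: mon_p; rewrite p0 mul0r add0r monicE lead_coefC => /eqP->.
  by rewrite !rmorph0 horner0 mul0r add0r rmorph1.
have {}mon_p : p \is monic.
  move: mon_p; rewrite !monicE lead_coefDl ?lead_coefMX //.
  by rewrite size_mulX // (leq_ltn_trans (size_polyC_leq1 _)) // ltnS size_poly_gt0.
move=> Qpc; have Qc : Q (phi c).
  suff : (phi @^-1` Q) c by [].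
  rewrite -(maxQ (phi @^-1` I)).
  - have := idealB idI (QI _ Qpc) (idealMl idI (map_poly phi p).[y] Iy).
    by rewrite addrAC subrr add0r.
  - exact: preimage_ideal.
  - by rewrite /preimage /= rmorph1.
  - by move=> x /QI.
have := idealB idQ Qpc Qc; rewrite addrK => /pQ[] //.
exact: IHp.
Qed.

End Integral.

Section Descent.
Variables (R : comNzRingType) (phi : {rmorphism R -> R}) (rho : {additive R -> R}).
Hypothesis rhoM : forall a b, rho (phi a * b) = a * rho b.
Hypothesis rho1 : rho 1 = 1.
Implicit Types (I J : set R) (s : seq R).

Lemma rhoK : cancel phi rho.
Proof. by move=> a; rewrite -[phi a]mulr1 rhoM rho1 mulr1. Qed.

Lemma rho_adjoins I J s : (forall x, I x -> J (rho x)) ->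
  forall x, adjoins I (map phi s) x -> adjoins J s (rho x).
Proof.
elim: s I J => //= a s IHs I J rIJ; apply: IHs => x [c Ic]; exists (rho c).
by have := rIJ _ Ic; rewrite raddfB /= mulrC rhoM mulrC.
Qed.

Lemma phi_adjoins I J s : (forall x, J x -> I (phi x)) ->
  forall x, adjoins J s x -> adjoins I (map phi s) (phi x).
Proof.
elim: s I J => //= a s IHs I J rIJ; apply: IHs => x [c Jc]; exists (phi c).
by have := rIJ _ Jc; rewrite rmorphB rmorphM.
Qed.

Lemma rseq_descent I J s :
  (forall x, I x -> J (rho x)) -> (forall x, J x -> I (phi x)) ->
  rseq I (map phi s) -> rseq J s.
Proof.
elim: s I J => //= a s IHs I J rIJ pJI [na sI]; split=> [y|].
  by move=> /pJI; rewrite rmorphM => /na /rIJ; rewrite rhoK.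
apply: IHs sI; first exact: (@rho_adjoins I J [:: a]).
exact: (@phi_adjoins I J [:: a]).
Qed.

Hypothesis going_down : forall P M Q,
  prime_ideal P -> prime_ideal Q -> phi @^-1` Q = M -> P `<=` M ->
  exists P', [/\ prime_ideal P', P' `<=` Q & phi @^-1` P' = P].

(** Going down lifts a chain from the top. *)
Lemma chain_going_down h P M Q :
  prime_chain M h P -> prime_ideal Q -> phi @^-1` Q = M ->
  exists2 P', prime_chain Q h P' & phi @^-1` (P' 0%N) = P 0%N.
Proof.
elim: h M Q => [|h IHh] M Q [PM pP ltP] pQ QM.
  by exists (fun=> Q); [split=> // i; rewrite leqn0 => /eqP->|rewrite PM].
have := ltP h (ltnSn h); rewrite PM => -[PhM MPh].
have [|P' [pP' P'Q P'P]] := @going_down (P h) M Q _ pQ QM PhM; first exact/pP/leqnSn.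
have [|P'' [P''P' pP'' ltP''] P''0] := IHh (P h) P' _ pP' P'P.
  by split=> // i ih; [apply/pP/(leq_trans ih) | apply/ltP/(leq_trans ih)].
exists (fun i => if (i <= h)%N then P'' i else Q) => //; split.
- by rewrite ltnn.
- by move=> i _; case: leqP => // /pP''.
- move=> i; rewrite ltnS; case: ltngtP => // [ih _|-> _]; first exact: ltP''.
  rewrite P''P'; split=> // QP'; apply: MPh.
  by rewrite -QM -P'P => x /QP'.
Qed.

Variables (I J : set R).
Hypotheses (idI : is_ideal I) (idJ : is_ideal J) (IJ : I `<=` J).
Hypothesis IJ_rad : forall x, J x -> exists n, I (x ^+ n).
Hypothesis rhoIJ : forall x, I x -> J (rho x).
Hypothesis phiJI : forall x, J x -> I (phi x).
Hypothesis phi_int : integralRange phi.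
Hypothesis I_over : forall Q, prime_ideal Q -> J `<=` phi @^-1` Q -> I `<=` Q.

Lemma same_primes P : prime_ideal P -> I `<=` P -> J `<=` P.
Proof. by move=> pP IP x /IJ_rad[n /IP]; apply: primeX. Qed.

(** The sequence s is extended one element at a time.  Should this fail before the
    length d is reached, phi(M) would lie in an associated prime Q over M; by going
    down the height of Q is at least d, so Q would contain a regular sequence
    longer than phi(s), which is maximal in Q. *)
Lemma rseq_phi M d : rel_cm I -> maximal_ideal M -> J `<=` M ->
  rel_height I M d -> forall r, (r <= d)%N ->
  exists s, [/\ rseq I (map phi s), [set` s] `<=` M & size s = r].
Proof.
move=> [In cmI] maxM JM [[P chP IP] _]; have [idM M1 _] := maxM.
elim=> [|r IHr] rd; first by exists [::].
have [s [Is sM sz]] := IHr (ltnW rd).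
have [K|[z Mz zK]|[K [u [KE Ku pu uM]]]] :=
    @common_nzd _ _ phi I [:: adjoins I (map phi s)] M idI In _ idM.
- by rewrite inE => /eqP->; split; [exact: adjoins_ideal|exact: sub_adjoins].
- exists (rcons s z); split; last by rewrite size_rcons sz.
    rewrite map_rcons; apply/rseq_rcons; split=> //; apply: zK.
    by rewrite inE.
  by move=> x; rewrite /= mem_rcons inE => /orP[/eqP->//|/sM].
move: KE; rewrite inE => /eqP KE.
(* The associated prime Q lies over M because M is maximal. *)
pose Q := colon K u.
have idK : is_ideal K by rewrite KE; apply: adjoins_ideal.
have QM : phi @^-1` Q = M.
  have [_ _ maxM'] := maxM; apply: maxM'; last exact: uM.
    exact/preimage_ideal/prime_ideal_ideal.
  by rewrite /preimage /= rmorph1; case: pu.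
have maxQ : maximal_ideal Q by apply: (integral_maximal phi_int) => //; rewrite QM.
have IQ : I `<=` Q.
  by move=> x Ix; apply: sub_colon => //; rewrite KE; apply: sub_adjoins Ix.
have [e [[[t [It tQ tsz]] _] [_ maxe]]] := cmI Q maxQ IQ.
have [P' chP' P'0] := chain_going_down chP pu QM.
have de : (d <= e)%N.
  apply: (maxe _ _ chP'); apply: I_over; first by case: chP' => _ + _; apply.
  by rewrite P'0; apply: same_primes => //; case: chP => _ + _; apply.
have : (size t <= size (map phi s))%N.
  apply: (@rseq_size_socle _ I Q) => //; first exact: prime_ideal_ideal.
    move=> _ /mapP[x xs ->]; suff : (phi @^-1` Q) x by [].
    by rewrite QM; apply: sM.
  by exists u; rewrite -KE.
by rewrite tsz size_map sz => er; have := leq_trans rd (leq_trans de er); rewrite ltnn.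
Qed.

(** Here rho splits phi, so that R / J is a direct summand of R / I. *)
Theorem rel_cm_descent : rel_cm I -> rel_cm J.
Proof.
move=> cmI; have [In htI] := cmI; split; first exact: noeth_modS In.
move=> M maxM JM; have [|d [_ htM]] := htI M maxM; first by move=> x /IJ/JM.
have chIJ h Q : prime_chain M h Q -> I `<=` Q 0 -> J `<=` Q 0.
  by move=> [_ pQ _]; apply: same_primes; apply: pQ.
exists d; split; last first.
  have [[Q chQ IQ] maxd] := htM; split; first by exists Q => //; exact: chIJ chQ IQ.
  by move=> h' Q' chQ' JQ'; apply: (maxd _ _ chQ') => x /IJ/JQ'.
split.
  have [s [Is sM sz]] := rseq_phi cmI maxM JM htM (leqnn d).
  by exists s; split=> //; apply: rseq_descent Is.
have pM := maximal_prime maxM.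
move=> s Js sM; have [|Q chQ JQ] := chain_of_rseq idJ pM _ Js.
  by apply: adjoins_min => //; apply: prime_ideal_ideal.
by case: htM => _; apply; [exact: chQ | move=> x /IJ/JQ].
Qed.

End Descent.
(** * Passage to the quotient ring *)

Section Quotient.
Variables (R A : comNzRingType) (f : {rmorphism R -> A}) (g : A -> R).
Hypothesis gK : cancel g f.
Variable J : set R.
Hypothesis kerf : forall x, f x = 0 <-> J x.
Implicit Types (I P M : set R) (N : set A) (s : seq R) (t : seq A).

Lemma ker_ideal : is_ideal J.
Proof.
split; first by apply/kerf; rewrite rmorph0.
  by move=> x y /kerf fx /kerf fy; apply/kerf; rewrite rmorphD fx fy addr0.
by move=> a x /kerf fx; apply/kerf; rewrite rmorphM fx mulr0.
Qed.

Lemma ker_sub_preimage N : is_ideal N -> J `<=` f @^-1` N.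
Proof. by move=> idN x /kerf fx; rewrite /preimage /= fx; apply: ideal0. Qed.

(** Membership in an ideal containing the kernel only depends on the image. *)
Lemma section_mem I x y : is_ideal I -> J `<=` I -> f x = f y -> I x -> I y.
Proof.
move=> idI JI fxy Ix; rewrite -[y](subKr x); apply: idealB => //.
by apply/JI/kerf; rewrite rmorphB fxy subrr.
Qed.

Lemma section_preimage N : g @^-1` (f @^-1` N) = N.
Proof. by apply/seteqP; split=> y; rewrite /preimage /= gK. Qed.

Lemma preimage_section I : is_ideal I -> J `<=` I -> f @^-1` (g @^-1` I) = I.
Proof.
by move=> idI JI; apply/seteqP; split=> x; rewrite /preimage /=;
   apply: section_mem => //; rewrite gK.
Qed.

Lemma section_ideal I : is_ideal I -> J `<=` I -> is_ideal (g @^-1` I).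
Proof.
move=> idI JI; split; rewrite /preimage /=.
- by apply: (section_mem idI JI _ (ideal0 idI)); rewrite gK rmorph0.
- move=> x y Ix Iy; apply: (section_mem idI JI _ (idealD idI Ix Iy)).
  by rewrite rmorphD !gK.
- move=> a x Ix; apply: (section_mem idI JI _ (idealMl idI (g a) Ix)).
  by rewrite rmorphM !gK.
Qed.

Lemma section_1 I : is_ideal I -> J `<=` I -> (g @^-1` I) 1 -> I 1.
Proof. by move=> idI JI; apply: section_mem => //; rewrite gK rmorph1. Qed.

Lemma section_prime P : prime_ideal P -> J `<=` P -> prime_ideal (g @^-1` P).
Proof.
move=> [idP P1 pP] JP; split; first exact: section_ideal.
  by move/(section_1 idP JP)/P1.
move=> x y; rewrite /preimage /= => Pxy; apply: pP.
by apply: section_mem Pxy => //; rewrite rmorphM !gK.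
Qed.

Lemma preimage_maximal N : maximal_ideal N -> maximal_ideal (f @^-1` N).
Proof.
move=> [idN N1 maxN]; split; first exact: preimage_ideal.
  by rewrite /preimage /= rmorph1.
move=> I idI I1 NI; have JI : J `<=` I.
  by move=> x /(ker_sub_preimage idN) /NI.
rewrite -(preimage_section idI JI); congr (f @^-1` _); apply: maxN.
- exact: section_ideal.
- by move/(section_1 idI JI)/I1.
- by move=> y Ny; apply: NI; rewrite /preimage /= gK.
Qed.

Lemma section_maximal M : maximal_ideal M -> J `<=` M -> maximal_ideal (g @^-1` M).
Proof.
move=> [idM M1 maxM] JM; split; first exact: section_ideal.
  by move/(section_1 idM JM)/M1.
move=> I idI I1 MI; rewrite -(section_preimage I); congr (g @^-1` _); apply: maxM.
- exact: preimage_ideal.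
- by rewrite /preimage /= rmorph1.
- by move=> x Mx; apply: MI; apply: section_mem Mx => //; rewrite gK.
Qed.

Lemma ideal_gen_map s x : ideal_gen [set` map f s] (f x) <-> adjoins J s x.
Proof.
split=> [gx|]; last first.
  suff : adjoins J s `<=` f @^-1` (ideal_gen [set` map f s]) by apply.
  apply: adjoins_min.
  - exact: preimage_ideal (ideal_gen_ideal _).
  - exact: ker_sub_preimage (ideal_gen_ideal _).
  - by move=> y ys; apply: ideal_gen_sub; rewrite /= map_f.
have idJs := adjoins_ideal s ker_ideal; have JJs := @sub_adjoins _ J s.
rewrite -(preimage_section idJs JJs); apply: gx; first exact: section_ideal.
move=> _ /mapP[y ys ->]; have := mem_adjoins ker_ideal ys.
by apply: section_mem => //; rewrite gK.
Qed.

Lemma regular_map s M : is_ideal M -> ~ M 1 -> J `<=` M -> [set` s] `<=` M ->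
  regular_sequence (map f s) <-> rseq J s.
Proof.
move=> idM M1 JM sM; split=> [[_ fs]|/rseq_nth Js].
  apply/rseq_nth => i si y; rewrite -ideal_gen_map map_take rmorphM => Jy.
  rewrite -ideal_gen_map map_take; apply: fs; rewrite ?size_map //.
  by rewrite (nth_map 0).
split; first by rewrite -(rmorph1 f) ideal_gen_map => /(adjoins_min idM JM sM).
move=> i; rewrite size_map => si y; rewrite -[y]gK (nth_map 0) // -rmorphM.
by rewrite -map_take !ideal_gen_map; apply: Js.
Qed.

Lemma map_section t : map f (map g t) = t.
Proof. exact: (mapK gK). Qed.

Lemma has_depth_preimage N d : is_ideal N -> ~ N 1 ->
  has_depth N d <-> rel_depth J (f @^-1` N) d.
Proof.
move=> idN N1; have JN := ker_sub_preimage idN; have idfN := preimage_ideal f idN.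
have fN1 : ~ (f @^-1` N) 1 by rewrite /preimage /= rmorph1.
have fNs s : [set` map f s] `<=` N <-> [set` s] `<=` f @^-1` N.
  split=> sN x; first by move=> xs; apply: sN; exact: map_f.
  by move=> /mapP[y ys ->]; exact: sN.
have E s : [set` s] `<=` f @^-1` N -> regular_sequence (map f s) <-> rseq J s.
  exact: regular_map.
split=> -[[s [ss sN sz]] maxs]; split.
- exists (map g s); rewrite size_map.
  have gsN : [set` map g s] `<=` f @^-1` N by apply/fNs; rewrite map_section.
  by split=> //; apply/E => //; rewrite map_section.
- by move=> t Jt tN; rewrite -(size_map f); apply: maxs; [apply/E | apply/fNs].
- by exists (map f s); rewrite size_map; split=> //; [apply/E | apply/fNs].
- move=> t; rewrite -[t]map_section => rt /fNs tN; rewrite size_map; apply: maxs => //.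
  exact/E.
Qed.

(** Chains are increasing, so J lies in all members as soon as it lies in the first. *)
Lemma prime_chain_sub (B : comNzRingType) (M : set B) h Q i :
  prime_chain M h Q -> (i <= h)%N -> Q 0 `<=` Q i.
Proof.
move=> [_ _ ltQ]; elim: i => [|i IHi] ih x // /(IHi (ltnW ih)).
by case: (ltQ i ih) => + _; apply.
Qed.

Lemma has_height_preimage N h : has_height N h <-> rel_height J (f @^-1` N) h.
Proof.
have down i Q : prime_chain N i Q ->
    prime_chain (f @^-1` N) i (fun j => f @^-1` (Q j)) /\ J `<=` f @^-1` (Q 0).
  move=> [QN pQ ltQ]; split; last exact: ker_sub_preimage (prime_ideal_ideal (pQ 0 _)).
  split=> [|j ji|j ji]; [by rewrite QN|exact: preimage_prime (pQ j ji)|].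
  have [QQ nQQ] := ltQ j ji; split=> [x /QQ //|QQ'].
  by apply: nQQ => y; rewrite -[y]gK => /QQ'.
have up i Q : prime_chain (f @^-1` N) i Q -> J `<=` Q 0 ->
    prime_chain N i (fun j => g @^-1` (Q j)).
  move=> chQ JQ; have [QN pQ ltQ] := chQ.
  have {}JQ j : (j <= i)%N -> J `<=` Q j.
    by move=> /(prime_chain_sub chQ) QQ x /JQ/QQ.
  split=> [|j ji|j ji]; first by rewrite QN section_preimage.
    by apply: section_prime; [exact: pQ|exact: JQ].
  have [QQ nQQ] := ltQ j ji; split=> [x /QQ //|QQ']; apply: nQQ.
  rewrite -(preimage_section (prime_ideal_ideal (pQ _ ji)) (JQ _ ji)).
  rewrite -(preimage_section (prime_ideal_ideal (pQ _ (ltnW ji))) (JQ _ (ltnW ji))).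
  by move=> x; apply: QQ'.
split=> [[[Q chQ] maxh]|[[Q chQ JQ] maxh]]; split.
- by have [chQ' JQ] := down _ _ chQ; exists (fun j => f @^-1` (Q j)).
- by move=> h' Q' chQ' JQ'; apply: maxh (up _ _ chQ' JQ').
- by exists (fun j => g @^-1` (Q j)); apply: up.
- by move=> h' Q' /down[chQ' JQ']; apply: maxh chQ' JQ'.
Qed.

Lemma noetherian_quotient : noetherian A <-> noeth_mod J.
Proof.
split=> An I idI.
  move=> JI; have [t It] := An _ (section_ideal idI JI); exists (map g t).
  rewrite -[I]preimage_section // It -[in LHS](map_section t).
  by apply/seteqP; split=> x; rewrite /preimage /= ideal_gen_map.
have [s Is] := An _ (preimage_ideal f idI) (ker_sub_preimage idI).
exists (map f s); rewrite -(section_preimage I) Is.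
apply/seteqP; split=> y; rewrite -[y in ideal_gen _ y]gK.
  by rewrite ideal_gen_map.
by rewrite ideal_gen_map.
Qed.

Theorem cohen_macaulay_quotient : cohen_macaulay A <-> rel_cm J.
Proof.
split=> -[/noetherian_quotient nA cmA]; split=> // M maxM.
  move=> JM; have [idM _ _] := maxM.
  have [d [depM htM]] := cmA _ (section_maximal maxM JM).
  exists d; rewrite -(preimage_section idM JM); split; last exact/has_height_preimage.
  have [idgM gM1 _] := section_maximal maxM JM.
  exact/has_depth_preimage.
have [idM M1 _] := maxM.
have [d [depM htM]] := cmA _ (preimage_maximal maxM) (ker_sub_preimage idM).
exists d; split; [exact/has_depth_preimage | exact/has_height_preimage].
Qed.

End Quotient.

Section QuotientIdeal.
Variable R : comNzRingType.

Lemma cohen_macaulay_idealP (I : set R) :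
  cohen_macaulay_ideal I <-> [/\ is_ideal I, ~ I 1 & rel_cm I].
Proof.
have cmP (J : idealr R) : (forall x, x \in J <-> I x) ->
    cohen_macaulay {ideal_quot J} <-> rel_cm I.
  move=> JI; pose f : {rmorphism R -> {ideal_quot J}} := \pi_({ideal_quot J})%qT.
  apply: (@cohen_macaulay_quotient _ _ f repr); first exact: reprK.
  move=> x; rewrite -JI -[x in x \in J]subr0 Quotient.idealrBE.
  split=> [fx|/eqP fx]; first exact/eqP/(etrans fx)/esym/(rmorph0 f).
  exact: etrans fx (rmorph0 f).
split=> [[J JI cmJ]|[idI I1 cmI]].
  split; last exact/(cmP J).
    split; first by apply/JI; exact: idealr0.
      by move=> x y /JI Jx /JI Jy; apply/JI; exact: rpredD.
    by move=> a x /JI Jx; apply/JI; exact: ring_quotient.idealMr.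
  by move=> /JI; rewrite idealr1.
pose p : pred R := fun x => `[< I x >].
have idp : idealr_closed p.
  split=> [||a x y].
  - exact/asboolP/(ideal0 idI).
  - exact/asboolP.
  - move=> /asboolP Ix /asboolP Iy; apply/asboolP.
    by apply: idealD => //; apply: idealMl.
pose J : idealr R := HB.pack p (isIdealr.Build R p idp).
have JI x : x \in J <-> I x by split=> /asboolP.
by exists J => //; apply/(cmP J).
Qed.
End QuotientIdeal.
(** * Going down for free extensions *)

Section FreeGoingDown.
Variables (R : comNzRingType) (phi : {rmorphism R -> R}) (B : finType).
Variables (rho : B -> {additive R -> R}) (e : B -> R).
Hypothesis rhoM : forall b x y, rho b (phi x * y) = x * rho b y.
Hypothesis rho_basis : forall x, x = \sum_b phi (rho b x) * e b.

(** Let E be the extension of P along phi, that is, the set of elements with all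
    coordinates in P.  If x * phi h is in E with h outside P, then all h * rho b x
    are in the prime P, so x is in E, hence in Q.  So E avoids the products of an
    element outside Q with the image of one outside P, and a prime that contains E
    and avoids these products has the required properties. *)
Lemma free_going_down (P M Q : set R) :
  prime_ideal P -> prime_ideal Q -> phi @^-1` Q = M -> P `<=` M ->
  exists P', [/\ prime_ideal P', P' `<=` Q & phi @^-1` P' = P].
Proof.
move=> pP pQ QM PM; have [idP P1 mP] := pP; have [idQ Q1 mQ] := pQ.
pose E : set R := [set x | forall b, P (rho b x)].
have idE : is_ideal E.
  split=> [b|x y Ex Ey b|a x Ex b].
  - by rewrite raddf0; apply: ideal0.
  - by rewrite raddfD; apply: idealD.
  - rewrite [x]rho_basis mulr_sumr raddf_sum; apply: ideal_sum => // c _.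
    by rewrite mulrCA rhoM; apply: idealMr.
have EQ : E `<=` Q.
  move=> x Ex; rewrite [x]rho_basis; apply: ideal_sum => // b _.
  apply: idealMr => //; suff: (phi @^-1` Q) (rho b x) by [].
  by rewrite QM; apply/PM/Ex.
pose T : set R := [set z | exists x h, [/\ ~ Q x, ~ P h & z = x * phi h]].
have [||_ _ [x [h [Qx Ph ->]]] [y [l [Qy Pl ->]]]|_ [x [h [Qx Ph ->]]] Exh|
     P' [pP' EP' TP']] := @prime_avoiding _ E T => //.
- by exists 1, 1; rewrite rmorph1 mulr1.
- exists (x * y), (h * l); rewrite rmorphM mulrACA; split=> //.
    by move/mQ=> [].
  by move/mP=> [].
- apply/Qx/EQ => b; have := Exh b; rewrite mulrC rhoM.
  by move/mP => [].
exists P'; split=> // [x P'x|].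
  apply: contrapT => Qx; apply: TP' P'x; exists x, 1.
  by rewrite rmorph1 mulr1.
apply/seteqP; split=> [x P'x|x Px].
  apply: contrapT => Px; apply: TP' P'x; exists 1, x.
  by rewrite mul1r.
by apply: (EP') => b; rewrite -[phi x]mulr1 rhoM; apply: idealMr.
Qed.

End FreeGoingDown.

(** * The substitution of m-th powers of the variables *)

Section MonomialMaps.
Variables (n : nat) (k : comNzRingType).
Local Notation S := {mpoly k[n]}.
Implicit Types (a b : 'X_{1..n}) (f g : S).

Section Linear.
Variable G : 'X_{1..n} -> S.

Definition linear_ext f : S := \sum_(a <- msupp f) f@_a *: G a.

Lemma linear_ext_seq r f : uniq r -> {subset msupp f <= r} ->
  linear_ext f = \sum_(a <- r) f@_a *: G a.
Proof.
move=> ur fr; rewrite [RHS](bigID (mem (msupp f))) /= [X in _ + X]big1 ?addr0.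
  rewrite -big_filter; apply: perm_big; apply: uniq_perm.
  - exact: msupp_uniq.
  - exact: filter_uniq.
  - by move=> a; rewrite mem_filter; case: (boolP (a \in _)) => // /fr ->.
by move=> a /memN_msupp_eq0 ->; rewrite scale0r.
Qed.

Lemma linear_ext_is_zmod_morphism : zmod_morphism linear_ext.
Proof.
move=> f g; pose r := undup (msupp f ++ msupp g).
have ur : uniq r by apply: undup_uniq.
rewrite (@linear_ext_seq r (f - g)) // ?(@linear_ext_seq r f) //
  ?(@linear_ext_seq r g) //; first last.
- by move=> a /msuppB_le; rewrite mem_undup.
- by move=> a af; rewrite mem_undup mem_cat af.
- by move=> a ag; rewrite mem_undup mem_cat ag orbT.
by rewrite -sumrB; apply: eq_bigr => a _; rewrite mcoeffB scalerBl.
Qed.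

HB.instance Definition _ := 
  GRing.isZmodMorphism.Build S S linear_ext linear_ext_is_zmod_morphism.

Lemma linear_extZ c f : linear_ext (c *: f) = c *: linear_ext f.
Proof.
rewrite (@linear_ext_seq (msupp f)) ?msupp_uniq //; last exact: msuppZ_le.
by rewrite scaler_sumr; apply: eq_bigr => a _; rewrite mcoeffZ scalerA.
Qed.

Lemma linear_extX a : linear_ext 'X_[a] = G a.
Proof. by rewrite /linear_ext msuppX big_seq1 mcoeffX eqxx scale1r. Qed.

End Linear.

Lemma mpoly_linear_ind (A : S -> Prop) : A 0 ->
  (forall f g, A f -> A g -> A (f + g)) ->
  (forall c f, A f -> A (c *: f)) -> (forall a, A 'X_[a]) -> forall f, A f.
Proof.
move=> A0 AD AZ AX; elim/mpolyind => // c a f _ _ Af; apply: AD => //.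
exact: AZ.
Qed.

Variable m' : nat.
Local Notation m := m'.+1.

Definition powX : S -> S := comp_mpoly [tuple 'X_i ^+ m | i < n].

HB.instance Definition _ := GRing.RMorphism.on powX.

Lemma powXZ c f : powX (c *: f) = c *: powX f.
Proof. exact: comp_mpolyZ. Qed.

Lemma powXX a : powX 'X_[a] = 'X_[a *+ m].
Proof.
rewrite /powX comp_mpolyX mpolyXE_id; apply: eq_bigr => i _.
by rewrite tnth_mktuple mulmnE exprM exprAC.
Qed.

Definition quot a : 'X_{1..n} := [multinom a i %/ m | i < n].
Definition residue a : {ffun 'I_n -> 'I_m} := [ffun i => inZp (a i)].
Definition residue_monomial (b : {ffun 'I_n -> 'I_m}) : 'X_{1..n} :=
  [multinom b i : nat | i < n].

Lemma quot_residue a : (quot a *+ m + residue_monomial (residue a))%MM = a.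
Proof.
by apply/mnmP => i; rewrite mnmDE mulmnE !mnmE ffunE /= -divn_eq.
Qed.

Lemma quotD a b : quot (a *+ m + b) = (a + quot b)%MM.
Proof. by apply/mnmP => i; rewrite !(mnmE, mulmnE, mnmDE) divnMDl. Qed.

Lemma residueD a b : residue (a *+ m + b) = residue b.
Proof.
apply/ffunP => i; apply/val_inj; rewrite !ffunE /= !(mnmE, mulmnE, mnmDE).
by rewrite modnMDl.
Qed.

(** The coordinate of a polynomial on the monomial with exponents b, in the basis of
    the monomials with exponents below m over the image of [powX]. *)
Definition residue_part (b : {ffun 'I_n -> 'I_m}) : S -> S :=
  linear_ext (fun a => if residue a == b then 'X_[quot a] else 0).

HB.instance Definition _ (b : {ffun 'I_n -> 'I_m}) := GRing.Additive.on (residue_part b).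

Lemma residue_partM (b : {ffun 'I_n -> 'I_m}) f g :
  residue_part b (powX f * g) = f * residue_part b g.
Proof.
elim/mpoly_linear_ind: f g => [|f f' IHf IHf'|c f IHf|a] g.
- by rewrite rmorph0 !mul0r raddf0.
- by rewrite rmorphD !mulrDl raddfD /= IHf IHf'.
- by rewrite powXZ -!scalerAl /residue_part linear_extZ -/(residue_part b _) IHf.
elim/mpoly_linear_ind: g => [|f f' IHf IHf'|c f IHf|a'].
- by rewrite raddf0 !mulr0 raddf0.
- by rewrite raddfD !mulrDr raddfD /= IHf IHf'.
- by rewrite -scalerAr /residue_part !linear_extZ -!/(residue_part b _) IHf scalerAr.
rewrite powXX -mpolyXD /residue_part !linear_extX residueD quotD.
by case: ifP; rewrite ?mulr0 // mpolyXD.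
Qed.

Lemma residue_part_basis f : f = \sum_b powX (residue_part b f) * 'X_[residue_monomial b].
Proof.
elim/mpoly_linear_ind: f => [|f f' IHf IHf'|c f IHf|a].
- by rewrite big1 // => b _; rewrite raddf0 rmorph0 mul0r.
- rewrite {1}IHf {1}IHf' -big_split; apply: eq_bigr => b _ /=.
  by rewrite raddfD rmorphD mulrDl.
- rewrite {1}IHf scaler_sumr; apply: eq_bigr => b _.
  by rewrite /residue_part linear_extZ powXZ scalerAl.
rewrite (bigD1 (residue a)) //= big1 => [|b bR].
  by rewrite addr0 /residue_part linear_extX eqxx powXX -mpolyXD quot_residue.
by rewrite /residue_part linear_extX eq_sym (negPf bR) rmorph0 mul0r.
Qed.

Lemma residue_part1 : residue_part [ffun=> ord0] 1 = 1.
Proof.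
rewrite -mpolyX0 /residue_part linear_extX.
have -> : residue 0%MM = [ffun=> ord0].
  by apply/ffunP => i; apply/val_inj; rewrite !ffunE /= mnmE mod0n.
by rewrite eqxx; congr 'X_[_]; apply/mnmP => i; rewrite !mnmE div0n.
Qed.

Lemma powX_integral : integralRange powX.
Proof.
have mapX i : integralOver powX ('X_i : S).
  exists ('X^m - ('X_i)%:P); first by rewrite monicXnsubC.
  rewrite rmorphB /= map_polyXn map_polyC /= rootE hornerD hornerN hornerXn hornerC.
  by rewrite powXX -mpolyXn subrr.
elim/mpoly_linear_ind => [|f g|c f|a].
- exact: integral0.
- exact: integral_add.
- rewrite -mul_mpolyC; apply: integral_mul.
  have <- : powX c%:MP = c%:MP by rewrite /powX comp_mpolyC.
  exact: integral_id.
- rewrite mpolyXE_id; apply: big_ind => [||i _]; first exact: integral1.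
    exact: integral_mul.
  elim: (a i) => [|d IHd]; first by rewrite expr0; apply: integral1.
  by rewrite exprS; apply: integral_mul.
Qed.

End MonomialMaps.

(** * Symbolic powers of Stanley-Reisner ideals *)

Section SymbolicPowers.
Variables (n : nat) (k : fieldType).
Local Notation S := {mpoly k[n]}.
Implicit Types (F : {set 'I_n}) (a b : 'X_{1..n}) (f g : S).

Definition weight F a := (\sum_(i | i \notin F) a i)%N.

(** The monomial ideal that turns out to be the j-th power of the face prime of F. *)
Definition min_weight F j : set S :=
  [set f | forall a, a \in msupp f -> (j <= weight F a)%N].

Lemma weightD F a b : weight F (a + b)%MM = (weight F a + weight F b)%N.
Proof. by rewrite -big_split; apply: eq_bigr => i _; rewrite mnmDE. Qed.

Lemma weightM F a d : weight F (a *+ d)%MM = (weight F a * d)%N.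
Proof. by rewrite /weight big_distrl; apply: eq_bigr => i _; rewrite mulmnE. Qed.

Lemma min_weightX F j a : min_weight F j 'X_[a] <-> (j <= weight F a)%N.
Proof.
split=> [Wa|ja b]; first by apply: Wa; rewrite msuppX inE.
by rewrite msuppX inE => /eqP->.
Qed.

Lemma min_weightM F i j f g :
  min_weight F i f -> min_weight F j g -> min_weight F (i + j) (f * g).
Proof.
move=> Wf Wg _ /msuppM_le/allpairsP[[a b] /= [af bg ->]].
by rewrite weightD leq_add //; [apply: Wf | apply: Wg].
Qed.

Lemma min_weight_ideal F j : is_ideal (min_weight F j).
Proof.
split=> [a|f g Wf Wg a|f g Wg].
- by rewrite msupp0.
- by move/msuppD_le; rewrite mem_cat => /orP[/Wf|/Wg].
- by rewrite -[j]add0n; apply: min_weightM Wg.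
Qed.

Lemma face_prime_weight F f : face_prime k F f -> min_weight F 1 f.
Proof.
apply; first exact: min_weight_ideal.
move=> _ [i iF ->]; apply/min_weightX.
by rewrite /weight (bigD1 i) //= mnm1E eqxx.
Qed.

Lemma monomial_face_factor F j a : (j <= weight F a)%N ->
  exists h (x : 'I_j -> S),
    (forall l, face_prime k F (x l)) /\ 'X_[a] = h * \prod_(l < j) x l.
Proof.
elim: j a => [|j IHj] a ja.
  by exists 'X_[a], (fun=> 0); split=> [[]//|]; rewrite big_ord0 mulr1.
have [i iF ai] : exists2 i, i \notin F & (0 < a i)%N.
  apply: contrapT => nai; move: ja; rewrite /weight big1 // => i iF.
  by apply/eqP; rewrite -leqn0 leqNgt; apply/negP => ai; apply: nai; exists i.
have Ua : (U_(i) <= a)%MM by rewrite lep1mP -lt0n.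
have aE := submK Ua.
have [|h [x [Px xE]]] := IHj (a - U_(i))%MM.
  move: ja; rewrite -{1}aE weightD addnC {1}/weight (bigD1 i) //= mnm1E eqxx.
  rewrite big1 ?addn0 // => l /andP[_ li]; rewrite mnm1E eq_sym.
  by rewrite (negPf li).
exists h, (fun l => if unlift ord0 l is Some l' then x l' else 'X_i); split.
  move=> l; case: unliftP => [l' _|_] //.
  by apply: ideal_gen_sub; exists i.
rewrite big_ord_recl unlift_none -{1}aE mpolyXD xE.
under [in RHS]eq_bigr => l _ do rewrite liftK.
by rewrite mulrCA mulrC mulrA.
Qed.

Lemma face_prime_pow F j f : ideal_pow (face_prime k F) j f <-> min_weight F j f.
Proof.
split=> [|Wf].
  apply; first exact: min_weight_ideal.
  move=> _ [x Px ->]; elim: j x Px => [|j IHj] x Px.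
    by move=> a _.
  rewrite big_ord_recl; apply: (@min_weightM F 1 j).
    exact: face_prime_weight.
  by apply: IHj => l; apply: Px.
have idP : is_ideal (ideal_pow (face_prime k F) j) by apply: ideal_gen_ideal.
rewrite [f]mpolyE big_seq; apply: ideal_sum => // a /Wf ja.
rewrite -mul_mpolyC; apply: (idealMl idP).
have [h [x [Px ->]]] := monomial_face_factor ja.
by apply: (idealMl idP); apply: ideal_gen_sub; exists x.
Qed.

Lemma sr_symbolic_powerP (Delta : {set {set 'I_n}}) j f :
  sr_symbolic_power k Delta j f <->
  forall F, F \in facets Delta -> min_weight F j f.
Proof. by split=> H F /H /face_prime_pow. Qed.

Lemma sr_symbolic_power_monomials (Delta : {set {set 'I_n}}) j f :
  sr_symbolic_power k Delta j f <->
  forall a, a \in msupp f -> sr_symbolic_power k Delta j 'X_[a].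
Proof.
split=> [/sr_symbolic_powerP Wf a af|Wf].
  by apply/sr_symbolic_powerP => F FD; apply/min_weightX/(Wf F FD).
apply/sr_symbolic_powerP => F FD a /Wf/sr_symbolic_powerP/(_ F FD).
by move/min_weightX.
Qed.

Lemma sr_symbolic_powerX (Delta : {set {set 'I_n}}) j a :
  sr_symbolic_power k Delta j 'X_[a] <->
  forall F, F \in facets Delta -> (j <= weight F a)%N.
Proof.
by split=> [/sr_symbolic_powerP W F /W /min_weightX //|W];
   apply/sr_symbolic_powerP => F /W /min_weightX.
Qed.

Lemma sr_symbolic_power_ideal (Delta : {set {set 'I_n}}) j :
  is_ideal (sr_symbolic_power k Delta j).
Proof.
split=> [F _|f g If Ig F FD|f g Ig F FD].
- exact: ideal0 (ideal_gen_ideal _).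
- by apply: (idealD (ideal_gen_ideal _)); [apply: If|apply: Ig].
- by apply: (idealMl (ideal_gen_ideal _)); apply: Ig.
Qed.

Lemma sr_symbolic_power_le (Delta : {set {set 'I_n}}) i j :
  (i <= j)%N -> sr_symbolic_power k Delta j `<=` sr_symbolic_power k Delta i.
Proof.
move=> ij f /sr_symbolic_powerP Wf; apply/sr_symbolic_powerP => F FD a af.
exact: leq_trans ij (Wf F FD a af).
Qed.

Lemma sr_symbolic_power_exp (Delta : {set {set 'I_n}}) i j f :
  sr_symbolic_power k Delta i f -> sr_symbolic_power k Delta (i * j) (f ^+ j).
Proof.
move=> /sr_symbolic_powerP Wf; apply/sr_symbolic_powerP => F FD.
elim: j => [|j IHj]; first by rewrite muln0.
by rewrite exprS mulnS; apply: min_weightM IHj; apply: Wf.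
Qed.

Section Descent.
Variables (Delta : {set {set 'I_n}}) (m' : nat).
Local Notation m := m'.+1.
Local Notation I j := (sr_symbolic_power k Delta j).

Lemma sr_symbolic_power_powX j f : I j f -> I (j * m) (powX m' f).
Proof.
move=> /sr_symbolic_power_monomials If.
rewrite [f]mpolyE big_seq raddf_sum /=; apply: ideal_sum => [|a /If Ia].
  exact: sr_symbolic_power_ideal.
rewrite powXZ powXX -mul_mpolyC.
apply: (idealMl (sr_symbolic_power_ideal _ _)).
by rewrite -mpolyXn; apply: sr_symbolic_power_exp.
Qed.

(** The hypothesis says (j - 1) * m < t: a monomial of weight at least t whose
    exponents are divisible by m has an m-th root of weight at least j. *)
Lemma sr_symbolic_power_residue j t f : (j * m < t + m)%N ->
  I t f -> I j (residue_part (m' := m') [ffun=> ord0] f).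
Proof.
move=> jt /sr_symbolic_power_monomials If.
rewrite /residue_part /linear_ext big_seq; apply: ideal_sum => [|a /If Ia].
  exact: sr_symbolic_power_ideal.
rewrite -mul_mpolyC; apply: (idealMl (sr_symbolic_power_ideal _ _)).
case: eqP => [ra|_]; last exact: ideal0 (sr_symbolic_power_ideal _ _).
have aE : a = (quot m' a *+ m)%MM.
  rewrite -[LHS](quot_residue m') ra; apply/mnmP => i.
  by rewrite mnmDE !mnmE ffunE addn0.
apply/sr_symbolic_powerX => F FD.
have /sr_symbolic_powerX/(_ F FD) := Ia.
rewrite {1}aE weightM => tw; rewrite -ltnS -(ltn_pmul2r (ltn0Sn m')) mulSn addnC.
by apply: leq_trans jt _; rewrite leq_add2r.
Qed.

(** The last condition of the descent, that a prime Q containing phi(I j) contains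
    I t, holds because I t is spanned by monomials of I j, and phi takes a monomial
    to its m-th power. *)
Lemma rel_cm_symbolic_power j t : (0 < j)%N -> (j <= t)%N ->
  (t <= j * m)%N -> (j * m < t + m)%N -> rel_cm (I t) -> rel_cm (I j).
Proof.
move=> j0 jt tjm jmt.
have rho_powX : forall x, I j x -> I t (powX m' x).
  by move=> x /sr_symbolic_power_powX; apply: sr_symbolic_power_le.
apply: (@rel_cm_descent _ (powX m') (residue_part [ffun=> ord0])) => //.
- exact: residue_partM.
- exact: residue_part1.
- pose rho (b : {ffun 'I_n -> 'I_m}) : {additive S -> S} := residue_part b.
  have gd := (@free_going_down _ (powX m') _ rho 
    (fun c => 'X_[residue_monomial c]) (@residue_partM _ _ _)
    (@residue_part_basis _ _ _)).
  move=> P M Q pP pQ QM PM; exact: gd pP pQ QM PM.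
- exact: sr_symbolic_power_ideal.
- exact: sr_symbolic_power_ideal.
- exact: sr_symbolic_power_le.
- move=> x Ix; exists t; apply: (@sr_symbolic_power_le _ _ (j * t)).
    exact: leq_pmull.
  exact: sr_symbolic_power_exp.
- by move=> x; apply: sr_symbolic_power_residue.
- exact: powX_integral.
move=> Q pQ JQ f /sr_symbolic_power_monomials If.
have idQ := prime_ideal_ideal pQ.
rewrite [f]mpolyE big_seq; apply: ideal_sum => // a /If Ia.
rewrite -mul_mpolyC; apply: (idealMl idQ); apply: (primeX (n := m) pQ).
have := JQ _ (sr_symbolic_power_le jt Ia).
by rewrite /preimage /= powXX mpolyXn.
Qed.

End Descent.

(** The conditions on j, t and m say that j is t / m rounded up. *)
Lemma cohen_macaulay_symbolic_power (Delta : {set {set 'I_n}}) j t m :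
  (0 < j)%N -> (j <= t)%N -> (t <= j * m)%N -> (j * m < t + m)%N ->
  cohen_macaulay_ideal (sr_symbolic_power k Delta t) ->
  cohen_macaulay_ideal (sr_symbolic_power k Delta j).
Proof.
case: m => [|m] j0 jt tjm jmt.
  by rewrite muln0 addn0 in jmt tjm; rewrite leqNgt jmt in tjm.
move=> /cohen_macaulay_idealP[idt It1 cmt]; apply/cohen_macaulay_idealP; split.
- exact: sr_symbolic_power_ideal.
- move=> /(sr_symbolic_power_powX (m' := m)); rewrite rmorph1.
  by move/(sr_symbolic_power_le tjm)/It1.
- exact: rel_cm_symbolic_power jmt cmt.
Qed.

End SymbolicPowers.

Theorem corollary4p4 (k : fieldType) (n : nat) (Delta : {set {set 'I_n}})
    (hDelta : simplicial_complex Delta) :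
  (exists2 t : nat, (3 <= t)%N &
     cohen_macaulay_ideal (sr_symbolic_power k Delta t)) ->
  cohen_macaulay_ideal (sr_symbolic_power k Delta 2).
Proof.
(* The exponent of the substitution is one less than the given power. *)
case=> -[//|t] t2; apply: (@cohen_macaulay_symbolic_power _ _ _ 2 t.+1 t) => //.
- exact: ltnW.
- by rewrite mul2n -addnn -addn1 leq_add2l ltnW.
- by rewrite mul2n -addnn addSn ltnS.
Qed.
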